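(* Let $M$ and $H$ be $3$-Lie algebras over a field $\mathbb F$ with $\operatorname{char}\mathbb F\neq 2$, and let $A=M\dot+H$ be a $(\mu,\rho,\beta)$-extension of $H$ by $M$, with bracket $[\,,,]_{\mu\rho\beta}$. Then $A$ is a $3$-Lie algebra if and only if the following identities hold for all $x,y,x_1,\dots,x_5\in M$ and $h,h_1,h_2,h_3\in H$: (1) $\rho(x_1,x_4)\rho(x_2,x_3)+\rho(x_2,x_3)\rho(x_1,x_4)+\rho(x_1,x_2)\rho(x_3,x_4)+\rho(x_3,x_4)\rho(x_1,x_2)-\rho(x_1,x_3)\rho(x_2,x_4)-\rho(x_2,x_4)\rho(x_1,x_3)=0$; (2) $\rho(x_4,[x_1,x_2,x_3])=\rho(x_3,x_1)\rho(x_4,x_2)-\rho(x_2,x_1)\rho(x_4,x_3)+\rho(x_2,x_3)\rho(x_4,x_1)-\beta(x_4,\mu(x_1,x_2,x_3))$; (3) $\beta(y,h_2)\beta(x,h_1)h-\beta(y,h)\beta(x,h_1)h_2-\beta(x,h_1)\beta(y,h_2)h=[\rho(x,y)h_1,h_2,h]$; (4) $\operatorname{ad}(\beta(x,h_1)h_3,h_2)+\operatorname{ad}(h_3,\beta(x,h_1)h_2)+\operatorname{ad}(\beta(x,h_3)h_2,h_1)=\beta(x,[h_1,h_2,h_3])$; (5) $[\mu(x_1,x_2,x_3),h_1,h_2]=\rho(x_2,x_3)\beta(x_1,h_1)h_2-\rho(x_1,x_3)\beta(x_2,h_1)h_2+\rho(x_1,x_2)\beta(x_3,h_1)h_2-\beta([x_1,x_2,x_3],h_1)h_2$;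 (6) $\beta(x_1,h_1)\rho(x_2,x_3)h_2+\beta(x_3,h_2)\rho(x_1,x_2)h_1=\rho(x_2,x_3)\beta(x_1,h_1)h_2+\beta(x_2,h_2)\rho(x_1,x_3)h_1$; (7) $\mu(x_1,x_2,[x_3,x_4,x_5])-\mu([x_1,x_2,x_3],x_4,x_5)-\mu(x_3,[x_1,x_2,x_4],x_5)-\mu(x_3,x_4,[x_1,x_2,x_5])=\rho(x_3,x_4)\mu(x_1,x_2,x_5)-\rho(x_3,x_5)\mu(x_1,x_2,x_4)-\rho(x_1,x_2)\mu(x_3,x_4,x_5)+\rho(x_4,x_5)\mu(x_1,x_2,x_3)$.
   Context: A $3$-Lie algebra is a vector space with a trilinear skew-symmetric bracket satisfying $[[x,y,z],u,v]=[[x,u,v],y,z]+[x,[y,u,v],z]+[x,y,[z,u,v]]$. A derivation is a linear map $d$ with $d[x,y,z]=[dx,y,z]+[x,dy,z]+[x,y,dz]$; $\operatorname{Der}(H)$ is the space of derivations of $H$. Brackets of $M$ and $H$ are written $[\,,,]$; $\operatorname{ad}(a,b)c=[a,b,c]$ for $a,b,c\in H$. $(\mu,\rho,\beta)$-extension: let $M,H$ be $3$-Lie algebras and $A=M\dot+H$ the direct sum of vector spaces. Let $\rho:M\wedge M\to\operatorname{Der}(H)$ (skew-symmetric bilinear), $\beta:M\wedge H\to\operatorname{Der}(H)$ (bilinear in $(x,h)\in M\times H$, with the convention $\beta(h,x)=-\beta(x,h)$) and $\mu:M\wedge M\wedge M\to H$ (skew-symmetric trilinear) be linear maps. The $(\mu,\rho,\beta)$-extension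 of $H$ by $M$ is $A$ with the skew-symmetric trilinear bracket determined by $[x,y,z]_{\mu\rho\beta}=[x,y,z]_M+\mu(x,y,z)$, $[x,y,h]_{\mu\rho\beta}=\rho(x,y)h$, $[x,h_1,h_2]_{\mu\rho\beta}=\beta(x,h_1)h_2$, $[h_1,h_2,h_3]_{\mu\rho\beta}=[h_1,h_2,h_3]_H$ for $x,y,z\in M$, $h,h_i\in H$. Since this bracket is required to be skew-symmetric, $\beta(x,h_1)h_2=-\beta(x,h_2)h_1$. It is not assumed a priori that $A$ is a $3$-Lie algebra. *)

(* Defs.v *)
From mathcomp Require Import all_boot all_order all_algebra.

Set Implicit Arguments.
Unset Strict Implicit.
Unset Printing Implicit Defensive.

Import GRing.Theory.
Local Open Scope ring_scope.

(* Skew-symmetry is stated on the two adjacent transpositions, which generate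
   S_3; brackets that vanish on repeated arguments are the same thing when
   2 is invertible. *)
Definition trilinear (F : fieldType) (U V : lmodType F) (f : U -> U -> U -> V) :=
  [/\ forall y z, linear (fun x => f x y z),
      forall x z, linear (fun y => f x y z)
    & forall x y, linear (fun z => f x y z)].

Definition skew3 (F : fieldType) (U V : lmodType F) (f : U -> U -> U -> V) :=
  (forall x y z, f y x z = - f x y z) /\ (forall x y z, f x z y = - f x y z).

Record three_lie_algebra (F : fieldType) (L : lmodType F)
    (br : L -> L -> L -> L) : Prop := {
  tl_trilinear : trilinear br;
  tl_skew : skew3 br;
  tl_identity : forall x y z u v,
    br (br x y z) u v = br (br x u v) y z + br x (br y u v) z
                        + br x y (br z u v) }.

Definition derivation (F : fieldType) (L : lmodType F) (br : L -> L -> L -> L)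
    (d : L -> L) : Prop :=
  linear d /\
  forall x y z, d (br x y z) = br (d x) y z + br x (d y) z + br x y (d z).

Definition ad (F : fieldType) (L : lmodType F) (br : L -> L -> L -> L)
    (a b : L) : L -> L := fun c => br a b c.

(* The maps mu : M /\ M /\ M -> H, rho : M /\ M -> Der(H) and
   beta : M /\ H -> Der(H), curried; linearity of a map into Der(H) is
   pointwise linearity.  beta(h, x) = - beta(x, h) is a notational convention,
   so only the values beta x h with x in M and h in H are data. *)
Record extension_data (F : fieldType) (M H : lmodType F)
    (brH : H -> H -> H -> H) (mu : M -> M -> M -> H)
    (rho : M -> M -> H -> H) (beta : M -> H -> H -> H) : Prop := {
  mu_trilinear : trilinear mu;
  mu_skew : skew3 mu;
  rho_der : forall x y, derivation brH (rho x y);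
  rho_linearl : forall y h, linear (fun x => rho x y h);
  rho_linearr : forall x h, linear (fun y => rho x y h);
  rho_skew : forall x y h, rho y x h = - rho x y h;
  beta_der : forall x h, derivation brH (beta x h);
  beta_linearl : forall h h', linear (fun x => beta x h h');
  beta_linearr : forall x h', linear (fun h => beta x h h') }.

(* The direct sum of M and H is the product module M * H, with x in M and
   h in H embedded as (x, 0) and (0, h). *)
Record extension_bracket (F : fieldType) (M H : lmodType F)
    (brM : M -> M -> M -> M) (brH : H -> H -> H -> H)
    (mu : M -> M -> M -> H) (rho : M -> M -> H -> H) (beta : M -> H -> H -> H)
    (brA : M * H -> M * H -> M * H -> M * H) : Prop := {
  ext_trilinear : trilinear brA;
  ext_skew : skew3 brA;
  ext_MMM : forall x y z,
    brA (x, 0) (y, 0) (z, 0) = (brM x y z, 0) + (0, mu x y z);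
  ext_MMH : forall x y h, brA (x, 0) (y, 0) (0, h) = (0, rho x y h);
  ext_MHH : forall x h1 h2, brA (x, 0) (0, h1) (0, h2) = (0, beta x h1 h2);
  ext_HHH : forall h1 h2 h3,
    brA (0, h1) (0, h2) (0, h3) = (0, brH h1 h2 h3) }.

(* The bracket above exists as soon as beta x h1 h2 is skew in (h1, h2) (which
   it forces), and it is unique: its explicit form is the following. *)
Definition ext_formula (F : fieldType) (M H : lmodType F)
    (brM : M -> M -> M -> M) (brH : H -> H -> H -> H)
    (mu : M -> M -> M -> H) (rho : M -> M -> H -> H) (beta : M -> H -> H -> H)
    (u v w : M * H) : M * H :=
  (brM u.1 v.1 w.1,
   mu u.1 v.1 w.1
   + (rho u.1 v.1 w.2 - rho u.1 w.1 v.2 + rho v.1 w.1 u.2)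
   + (beta u.1 v.2 w.2 - beta v.1 u.2 w.2 + beta w.1 u.2 v.2)
   + brH u.2 v.2 w.2).

Section ExtBracket.
Variables (F : fieldType) (M H : lmodType F).
Variables (brM : M -> M -> M -> M) (brH : H -> H -> H -> H).
Variables (mu : M -> M -> M -> H) (rho : M -> M -> H -> H).
Variable beta : M -> H -> H -> H.

Lemma linear_at0 (U V : lmodType F) (f : U -> V) : linear f -> f 0 = 0.
Proof. by move=> lf; have := lf (-1) 0 0; rewrite scaler0 addr0 scaleN1r addNr. Qed.

Lemma linear_comb (U V : lmodType F) (f : U -> V) (a : F) u v :
  linear f -> f (a *: u + v) = a *: f u + f v.
Proof. by move=> lf; apply: lf. Qed.

Lemma ext_bracket_skew_beta brA :
  extension_bracket brM brH mu rho beta brA ->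
  forall x h1 h2, beta x h1 h2 = - beta x h2 h1.
Proof.
move=> [_ [_ sk] _ _ MHH _] x h1 h2.
by have := sk (x, 0) (0, h2) (0, h1); rewrite !MHH => -[_ ->].
Qed.

Lemma ext_bracket_unique brA :
  extension_bracket brM brH mu rho beta brA ->
  forall u v w, brA u v w = ext_formula brM brH mu rho beta u v w.
Proof.
move=> [[l1 l2 l3] [s12 s23] MMM MMH MHH HHH] [x a] [y b] [z c].
have dec (m : M) (h : H) : (m, h) = 1 *: (m, 0) + (0, h).
  by rewrite scale1r; congr pair; rewrite /= ?addr0 ?add0r.
rewrite (dec x a) (dec y b) (dec z c).
rewrite (linear_comb _ _ _ (l1 _ _)) !(linear_comb _ _ _ (l2 _ _)).
rewrite !(linear_comb _ _ _ (l3 _ _)) !scale1r.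
rewrite (s23 (x, 0) (z, 0) (0, b)) (s12 (y, 0) (0, a) (z, 0)).
rewrite (s23 (y, 0) (z, 0) (0, a)) (s12 (y, 0) (0, a) (0, c)).
rewrite (s23 (0, a) (z, 0) (0, b)) (s12 (z, 0) (0, a) (0, b)).
rewrite !(MMM, MMH, MHH, HHH) /ext_formula /=.
congr pair; rewrite /= ?(oppr0, addr0, add0r, opprK) //.
by rewrite !addrA [LHS](ACl (1*2*3*5*4*6*7*8)).
Qed.

Lemma lin_add (U V : lmodType F) (f g : U -> V) :
  linear f -> linear g -> linear (fun x => f x + g x).
Proof. by move=> lf lg a u v; rewrite lf lg scalerDr addrACA. Qed.

Lemma lin_opp (U V : lmodType F) (f : U -> V) :
  linear f -> linear (fun x => - f x).
Proof. by move=> lf a u v; rewrite lf opprD scalerN. Qed.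

Lemma lin_pair (U V W : lmodType F) (f : U -> V) (g : U -> W) :
  linear f -> linear g -> linear (fun x => (f x, g x)).
Proof. by move=> lf lg a u v; rewrite lf lg. Qed.

Lemma lin_fst (U V W : lmodType F) (f : U -> W) :
  linear f -> linear (fun x : U * V => f x.1).
Proof. by move=> lf a u v; rewrite lf. Qed.

Lemma lin_snd (U V W : lmodType F) (f : V -> W) :
  linear f -> linear (fun x : U * V => f x.2).
Proof. by move=> lf a u v; rewrite lf. Qed.

Lemma ext_formulaP :
  three_lie_algebra brM -> three_lie_algebra brH ->
  extension_data brH mu rho beta ->
  (forall x h1 h2, beta x h1 h2 = - beta x h2 h1) ->
  extension_bracket brM brH mu rho beta (ext_formula brM brH mu rho beta).
Proof.
move=> [[M1 M2 M3] [sM sM'] _] [[H1 H2 H3] [sH sH'] _].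
case=> -[m1 m2 m3] [sm sm'] dr r1 r2 sr db b1 b2 sb.
have r3 x y : linear (rho x y) by case: (dr x y).
have b3 x h : linear (beta x h) by case: (db x h).
have zr1 y h : rho 0 y h = 0 by apply: (linear_at0 (r1 y h)).
have zr2 x h : rho x 0 h = 0 by apply: (linear_at0 (r2 x h)).
have zr3 x y : rho x y 0 = 0 by apply: (linear_at0 (r3 x y)).
have zb1 h h' : beta 0 h h' = 0 by apply: (linear_at0 (b1 h h')).
have zb2 x h : beta x 0 h = 0 by apply: (linear_at0 (b2 x h)).
have zb3 x h : beta x h 0 = 0 by apply: (linear_at0 (b3 x h)).
have zm1 y z : mu 0 y z = 0 by apply: (linear_at0 (m1 y z)).
have zm3 x y : mu x y 0 = 0 by apply: (linear_at0 (m3 x y)).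
have zM1 y z : brM 0 y z = 0 by apply: (linear_at0 (M1 y z)).
have zM3 x y : brM x y 0 = 0 by apply: (linear_at0 (M3 x y)).
have zH1 y z : brH 0 y z = 0 by apply: (linear_at0 (H1 y z)).
have zE := (zr1, zr2, zr3, zb1, zb2, zb3, (zm1, zm3, zM1, zM3, zH1)).
have addE := (oppr0, addr0, add0r).
split.
- split=> u v; rewrite /ext_formula; apply: lin_pair;
    repeat (apply: lin_add || apply: lin_opp);
    first [ exact: (lin_fst (M1 _ _)) | exact: (lin_fst (M2 _ _))
          | exact: (lin_fst (M3 _ _)) | exact: (lin_fst (m1 _ _))
          | exact: (lin_fst (m2 _ _)) | exact: (lin_fst (m3 _ _))
          | exact: (lin_fst (r1 _ _)) | exact: (lin_fst (r2 _ _))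
          | exact: (lin_fst (b1 _ _)) | exact: (lin_snd (r3 _ _))
          | exact: (lin_snd (b2 _ _)) | exact: (lin_snd (b3 _ _))
          | exact: (lin_snd (H1 _ _)) | exact: (lin_snd (H2 _ _))
          | exact: (lin_snd (H3 _ _)) ].
- split=> u v w; rewrite /ext_formula.
  + rewrite (sM u.1) (sm u.1) (sH u.2) (sr u.1 v.1) (sb w.1 v.2).
    congr pair; rewrite /= !opprD !opprK.
    by rewrite !addrA [LHS](ACl (1*2*4*3*6*5*7*8)).
  + rewrite (sM' u.1) (sm' u.1) (sH' u.2) (sr v.1 w.1) (sb u.1 w.2).
    congr pair; rewrite /= !opprD !opprK.
    by rewrite !addrA [LHS](ACl (1*3*2*4*5*7*6*8)).
- by move=> x y z; rewrite /ext_formula /= !(zE, addE); congr pair; rewrite /= !addE.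
- by move=> x y h; rewrite /ext_formula /= !(zE, addE).
- by move=> x y h; rewrite /ext_formula /= !(zE, addE).
- by move=> x y h; rewrite /ext_formula /= !(zE, addE).
Qed.

End ExtBracket.

(* Main.v *)
(** The defect of the fundamental identity on A = M + H is additive in its five
arguments and skew in the first three and in the last two, so it vanishes as
soon as it vanishes on the twelve kinds of arguments lying in M or in H.  The
kinds HHH|MM, HHH|MH and HHH|HH hold because rho and beta take values in
derivations and H is a 3-Lie algebra.  The kinds MMM|MM, MMM|MH, MMM|HH, MMH|MH,
MHH|MH and MHH|HH are (7), (2), (5), (6), (3) and (4); modulo (2), MMH|MM is (1).
The remaining kinds MHH|MM and MMH|HH are integral linear combinations of
instances of (5), (6), and of (3), respectively. *)

Require Import Defs.
From mathcomp Require Import all_boot all_order all_algebra.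
Set Implicit Arguments.
Unset Strict Implicit.
Unset Printing Implicit Defensive.
Import GRing.Theory.
Local Open Scope ring_scope.

(* [zmod] proves equalities that hold in every Z-module, by comparing the integer
   coefficients of the atoms; [ring] only covers ring carriers. *)
Inductive zexpr := ZVar of nat | ZZero | ZAdd of zexpr & zexpr | ZOpp of zexpr.

Fixpoint zeval (V : zmodType) (env : seq V) (e : zexpr) : V :=
  match e with
  | ZVar n => env`_n
  | ZZero => 0
  | ZAdd e1 e2 => zeval env e1 + zeval env e2
  | ZOpp e1 => - zeval env e1
  end.

Fixpoint zcoef (e : zexpr) (i : nat) : int :=
  match e with
  | ZVar n => if n == i then 1 else 0
  | ZZero => 0
  | ZAdd e1 e2 => zcoef e1 i + zcoef e2 i
  | ZOpp e1 => - zcoef e1 i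
  end.

(** The normal form: an expression is the integer combination of its atoms. An index beyond [env]
    reads the default 0, in agreement with a sum that never reaches it. *)
Lemma zevalE (V : zmodType) (env : seq V) e :
  zeval env e = \sum_(i < size env) env`_i *~ zcoef e i.
Proof.
elim: e => [n||e1 IH1 e2 IH2|e IH] /=.
- have [lt_n|le_n] := ltnP n (size env).
    rewrite (bigD1 (Ordinal lt_n)) //= eqxx mulr1z big1 ?addr0 // => i.
    by rewrite -val_eqE eq_sym /= => /negPf ->; rewrite mulr0z.
  rewrite nth_default // big1 // => i _.
  by rewrite gtn_eqF ?mulr0z // (leq_trans (ltn_ord i)).
- by rewrite big1.
- by rewrite IH1 IH2 -big_split; apply: eq_bigr => i _; rewrite mulrzDr.
- by rewrite IH -sumrN; apply: eq_bigr => i _; rewrite mulrNz.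
Qed.

(** The hypothesis compares closed integers, so it is settled by evaluation. It is sufficient only,
    since atoms may satisfy relations of their own. *)
Lemma zeval_eq (V : zmodType) (env : seq V) e1 e2 :
  all (fun i => zcoef e1 i == zcoef e2 i) (iota 0 (size env)) ->
  zeval env e1 = zeval env e2.
Proof.
move/allP=> eq_coef; rewrite !zevalE; apply: eq_bigr => i _.
by rewrite (eqP (eq_coef i _)) // mem_iota /=.
Qed.

Ltac zmod_index t env :=
  lazymatch env with
  | t :: _ => constr:(0%N)
  | _ :: ?env' => let n := zmod_index t env' in constr:(S n)
  end.

(** Atoms are identified syntactically, so skew arguments must be put in a common order before
    [zmod] runs. Subtraction needs no case, being notation for [a + - b]. *)
Ltac zmod_atoms t env :=
  lazymatch t with
  | ?a + ?b => let env' := zmod_atoms a env in zmod_atoms b env'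
  | - ?a => zmod_atoms a env
  | 0 => env
  | _ => match env with
         | context [t :: _] => env
         | _ => constr:(t :: env)
         end
  end.

Ltac zmod_reify t env :=
  lazymatch t with
  | ?a + ?b => let x := zmod_reify a env in let y := zmod_reify b env in
               constr:(ZAdd x y)
  | - ?a => let x := zmod_reify a env in constr:(ZOpp x)
  | 0 => constr:(ZZero)
  | _ => let n := zmod_index t env in constr:(ZVar n)
  end.

Ltac zmod :=
  lazymatch goal with
  | |- @eq ?V ?a ?b =>
    let env := zmod_atoms a (@nil V) in
    let env := zmod_atoms b env in
    let x := zmod_reify a env in
    let y := zmod_reify b env in
    apply: (@zeval_eq _ env x y); vm_compute; reflexivity
  end.


(** * Combining equations; consequences of linearity and skew-symmetry *)

(** Deduces a goal from a known equation with the same formal difference of sides: the second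
    premise, [X - Y = A - B] without subtraction, is a pure Z-module identity left to [zmod]. *)
Lemma zmod_from (V : zmodType) (A B X Y : V) : A = B -> X + B = Y + A -> X = Y.
Proof. by move=> -> /addIr. Qed.

Lemma eqD (V : zmodType) (A B C D : V) : A = B -> C = D -> A + C = B + D.
Proof. by move=> -> ->. Qed.

Lemma eqN (V : zmodType) (A B : V) : A = B -> - A = - B.
Proof. by move=> ->. Qed.

Lemma skew3_cycle (F : fieldType) (U V : lmodType F) (f : U -> U -> U -> V) :
  skew3 f -> forall x y z, f y z x = f x y z.
Proof. by move=> [s12 s23] x y z; rewrite s23 s12 opprK. Qed.

Lemma linear_opp (F : fieldType) (U V : lmodType F) (f : U -> V) x :
  linear f -> f (- x) = - f x.
Proof.
move=> lf; have := lf (-1) x 0.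
by rewrite !scaleN1r (linear_at0 lf) !addr0.
Qed.

Lemma linear_add (F : fieldType) (U V : lmodType F) (f : U -> V) x y :
  linear f -> f (x + y) = f x + f y.
Proof. by move=> lf; have := lf 1 x y; rewrite !scale1r. Qed.

(** * The defect of the fundamental identity and its symmetries *)

(** It measures how far [fun x => br x u v] is from being a derivation of [br]. *)
Definition filippov (F : fieldType) (L : lmodType F) (br : L -> L -> L -> L)
    (x y z u v : L) : L :=
  br (br x y z) u v
  - (br (br x u v) y z + br x (br y u v) z + br x y (br z u v)).

Section Filippov.
Variables (F : fieldType) (M H : lmodType F).
Variable br : M * H -> M * H -> M * H -> M * H.
Hypotheses (lin : trilinear br) (skew : skew3 br).
Local Notation J := (filippov br).

Let brD1 x x' y z : br (x + x') y z = br x y z + br x' y z.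
Proof. by case: lin => l _ _; apply: (linear_add _ _ (l y z)). Qed.
Let brD2 x y y' z : br x (y + y') z = br x y z + br x y' z.
Proof. by case: lin => _ l _; apply: (linear_add _ _ (l x z)). Qed.
Let brD3 x y z z' : br x y (z + z') = br x y z + br x y z'.
Proof. by case: lin => _ _ l; apply: (linear_add _ _ (l x y)). Qed.
Let brN1 x y z : br (- x) y z = - br x y z.
Proof. by case: lin => l _ _; apply: (linear_opp _ (l y z)). Qed.
Let brN2 x y z : br x (- y) z = - br x y z.
Proof. by case: lin => _ l _; apply: (linear_opp _ (l x z)). Qed.
Let brN3 x y z : br x y (- z) = - br x y z.
Proof. by case: lin => _ _ l; apply: (linear_opp _ (l x y)). Qed.
Let brD := (brD1, brD2, brD3).
Let brN := (brN1, brN2, brN3).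
Let s12 := skew.1.
Let s23 := skew.2.

Lemma filippov_skew12 x y z u v : J y x z u v = - J x y z u v.
Proof.
rewrite /filippov (s12 x y z) brN1 (s12 x (br y u v)) (s12 (br x u v) y).
by rewrite (s12 x y (br z u v)); zmod.
Qed.

Lemma filippov_skew23 x y z u v : J x z y u v = - J x y z u v.
Proof.
rewrite /filippov (s23 x y z) brN1 (s23 (br x u v) y z) (s23 x (br y u v)).
by rewrite (s23 x y (br z u v)); zmod.
Qed.

Lemma filippov_skew45 x y z u v : J x y z v u = - J x y z u v.
Proof.
by rewrite /filippov !(s23 _ u v) brN1 brN2 brN3; zmod.
Qed.

(** Up to sign, arguments from [M] can be placed before those from [H], separately among the first
    three and among the last two: 4 times 3 patterns remain. *)
Lemma filippov_direct_sum :
  (forall x y z u v, J (x, 0) (y, 0) (z, 0) (u, 0) (v, 0) = 0) ->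
  (forall x y z u h, J (x, 0) (y, 0) (z, 0) (u, 0) (0, h) = 0) ->
  (forall x y z h k, J (x, 0) (y, 0) (z, 0) (0, h) (0, k) = 0) ->
  (forall x y h u v, J (x, 0) (y, 0) (0, h) (u, 0) (v, 0) = 0) ->
  (forall x y h u k, J (x, 0) (y, 0) (0, h) (u, 0) (0, k) = 0) ->
  (forall x y h k l, J (x, 0) (y, 0) (0, h) (0, k) (0, l) = 0) ->
  (forall x h k u v, J (x, 0) (0, h) (0, k) (u, 0) (v, 0) = 0) ->
  (forall x h k u l, J (x, 0) (0, h) (0, k) (u, 0) (0, l) = 0) ->
  (forall x h k l m, J (x, 0) (0, h) (0, k) (0, l) (0, m) = 0) ->
  (forall h k l u v, J (0, h) (0, k) (0, l) (u, 0) (v, 0) = 0) ->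
  (forall h k l u m, J (0, h) (0, k) (0, l) (u, 0) (0, m) = 0) ->
  (forall h k l m n, J (0, h) (0, k) (0, l) (0, m) (0, n) = 0) ->
  forall a b c d e, J a b c d e = 0.
Proof.
move=> J0 J1 J2 J3 J4 J5 J6 J7 J8 J9 J10 J11.
have J45 x y z u v : J x y z u v = 0 -> J x y z v u = 0.
  by move=> Jz; rewrite filippov_skew45 Jz oppr0.
have J23 x y z u v : J x y z u v = 0 -> J x z y u v = 0.
  by move=> Jz; rewrite filippov_skew23 Jz oppr0.
have J12 x y z u v : J x y z u v = 0 -> J y x z u v = 0.
  by move=> Jz; rewrite filippov_skew12 Jz oppr0.
have JE := (J0, J1, J2, J3, (J4, J5, J6, J7), (J8, J9, J10, J11)).
have dec (m : M * H) : m = (m.1, 0) + (0, m.2).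
  by case: m => m h; congr pair; rewrite /= ?addr0 ?add0r.
(* Splitting the last two arguments while the first three stay fixed makes each of the four patterns
   of the latter consume just three hypotheses. *)
have split45 x y z :
    (forall u v, J x y z (u, 0) (v, 0) = 0) ->
    (forall u k, J x y z (u, 0) (0, k) = 0) ->
    (forall l k, J x y z (0, l) (0, k) = 0) -> forall d e, J x y z d e = 0.
  move=> Ja Jb Jc d e; rewrite (dec d) (dec e).
  rewrite [LHS](_ : _ = J x y z (d.1, 0) (e.1, 0) + J x y z (0, d.2) (e.1, 0)
     + (J x y z (d.1, 0) (0, e.2) + J x y z (0, d.2) (0, e.2))).
    by rewrite Ja Jb Jc (J45 _ _ _ _ _ (Jb _ _)) !addr0.
  by rewrite /filippov !brD; zmod.
have Jmmm x y z d e : J (x, 0) (y, 0) (z, 0) d e = 0 by apply: split45.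
have Jmmh x y h d e : J (x, 0) (y, 0) (0, h) d e = 0 by apply: split45.
have Jmhh x h k d e : J (x, 0) (0, h) (0, k) d e = 0 by apply: split45.
have Jhhh h k l d e : J (0, h) (0, k) (0, l) d e = 0 by apply: split45.
move=> a b c d e; rewrite (dec a) (dec b) (dec c).
have JD1 x x' y z : J (x + x') y z d e = J x y z d e + J x' y z d e.
  by rewrite /filippov !brD; zmod.
have JD2 x y y' z : J x (y + y') z d e = J x y z d e + J x y' z d e.
  by rewrite /filippov !brD; zmod.
have JD3 x y z z' : J x y (z + z') d e = J x y z d e + J x y z' d e.
  by rewrite /filippov !brD; zmod.
have Jmhm x h y : J (x, 0) (0, h) (y, 0) d e = 0 by apply: J23.
have Jhmm h x y : J (0, h) (x, 0) (y, 0) d e = 0 by apply: J12.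
have Jhmh h x k : J (0, h) (x, 0) (0, k) d e = 0 by apply: J12.
have Jhhm h k x : J (0, h) (0, k) (x, 0) d e = 0 by apply: J23.
rewrite JD1 !JD2 !JD3 Jmmm Jmmh Jmhm Jmhh Jhmm Jhmh Jhhm Jhhh.
by rewrite !addr0.
Qed.

End Filippov.

(** * The defect on homogeneous arguments of the extension *)

Section Extension.
Variables (F : fieldType) (M H : lmodType F).
Variables (brM : M -> M -> M -> M) (brH : H -> H -> H -> H).
Variables (mu : M -> M -> M -> H) (rho : M -> M -> H -> H).
Variable beta : M -> H -> H -> H.
Variable brA : M * H -> M * H -> M * H -> M * H.
Hypotheses (lieM : three_lie_algebra brM) (lieH : three_lie_algebra brH).
Hypothesis data : extension_data brH mu rho beta.
Hypothesis ext : extension_bracket brM brH mu rho beta brA.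

Local Notation J := (filippov brA).

Let bs : forall x h k, beta x k h = - beta x h k.
Proof. by move=> x h k; apply: (ext_bracket_skew_beta ext). Qed.

(** On arguments purely in [M] or in [H] most terms of [ext_formula] have a zero argument; this
    family of rules erases them. *)
Let zero : (forall y h, rho 0 y h = 0) * (forall x h, rho x 0 h = 0)
  * (forall x y, rho x y 0 = 0) * (forall h k, beta 0 h k = 0)
  * (forall x k, beta x 0 k = 0) * (forall x h, beta x h 0 = 0)
  * (forall y z, mu 0 y z = 0) * (forall x z, mu x 0 z = 0)
  * (forall x y, mu x y 0 = 0) * (forall y z, brM 0 y z = 0)
  * (forall x z, brM x 0 z = 0) * (forall x y, brM x y 0 = 0)
  * (forall y z, brH 0 y z = 0) * (forall x z, brH x 0 z = 0)
  * (forall x y, brH x y 0 = 0).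
Proof.
case: lieM lieH data => -[M1 M2 M3] _ _ [[H1 H2 H3] _ _].
case=> -[m1 m2 m3] _ dr r1 r2 _ db b1 b2.
have r3 x y : linear (rho x y) by case: (dr x y).
have b3 x h : linear (beta x h) by case: (db x h).
by do ?apply: pair; move=> a b;
  first [ exact: (linear_at0 (r1 _ _)) | exact: (linear_at0 (r2 _ _))
        | exact: (linear_at0 (r3 _ _)) | exact: (linear_at0 (b1 _ _))
        | exact: (linear_at0 (b2 _ _)) | exact: (linear_at0 (b3 _ _))
        | exact: (linear_at0 (m1 _ _)) | exact: (linear_at0 (m2 _ _))
        | exact: (linear_at0 (m3 _ _)) | exact: (linear_at0 (M1 _ _))
        | exact: (linear_at0 (M2 _ _)) | exact: (linear_at0 (M3 _ _))
        | exact: (linear_at0 (H1 _ _)) | exact: (linear_at0 (H2 _ _))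
        | exact: (linear_at0 (H3 _ _)) ].
Qed.

Let neg : (forall x y h, rho x y (- h) = - rho x y h)
  * (forall x h k, beta x (- h) k = - beta x h k)
  * (forall x h k, beta x h (- k) = - beta x h k)
  * (forall h k l, brH (- h) k l = - brH h k l)
  * (forall h k l, brH h (- k) l = - brH h k l)
  * (forall h k l, brH h k (- l) = - brH h k l).
Proof.
case: lieH data => -[H1 H2 H3] _ _ [_ _ dr _ _ _ db _ b2].
have r3 x y : linear (rho x y) by case: (dr x y).
have b3 x h : linear (beta x h) by case: (db x h).
by do ?apply: pair; move=> a b c;
  first [ exact: (linear_opp _ (r3 _ _)) | exact: (linear_opp _ (b2 _ _))
        | exact: (linear_opp _ (b3 _ _)) | exact: (linear_opp _ (H1 _ _))
        | exact: (linear_opp _ (H2 _ _)) | exact: (linear_opp _ (H3 _ _)) ].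
Qed.

(** Uniqueness of the extension bracket lets [ext_formula] compute the inner and outer brackets
    alike; what survives is a Z-linear identity in each component. *)
Ltac expand :=
  rewrite /filippov !(ext_bracket_unique ext) /ext_formula /=;
  rewrite !(zero, neg, oppr0, addr0, add0r);
  apply: injective_projections; rewrite /= ?(oppr0, addr0, add0r) //; zmod.

(** The one kind whose [M] component need not cancel formally: it is the defect of [M] itself. *)
Lemma filippov_MMM_MM x y z u v :
  J (x, 0) (y, 0) (z, 0) (u, 0) (v, 0)
  = (filippov brM x y z u v,
     mu (brM x y z) u v + rho u v (mu x y z)
     - (mu (brM x u v) y z + rho y z (mu x u v)
        + mu x (brM y u v) z - rho x z (mu y u v)
        + mu x y (brM z u v) + rho x y (mu z u v))).
Proof. expand. Qed.

Lemma filippov_MMM_MH x y z u h :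
  J (x, 0) (y, 0) (z, 0) (u, 0) (0, h)
  = (0, rho (brM x y z) u h - beta u (mu x y z) h
        - (rho y z (rho x u h) - rho x z (rho y u h) + rho x y (rho z u h))).
Proof. expand. Qed.

Lemma filippov_MMM_HH x y z h k :
  J (x, 0) (y, 0) (z, 0) (0, h) (0, k)
  = (0, beta (brM x y z) h k + brH (mu x y z) h k
        - (rho y z (beta x h k) - rho x z (beta y h k) + rho x y (beta z h k))).
Proof. expand. Qed.

Lemma filippov_MMH_MM x y h u v :
  J (x, 0) (y, 0) (0, h) (u, 0) (v, 0)
  = (0, rho u v (rho x y h)
        - (rho (brM x u v) y h - beta y (mu x u v) h
           + rho x (brM y u v) h + beta x (mu y u v) h + rho x y (rho u v h))).
Proof. expand. Qed.

Lemma filippov_MMH_MH x y h u k :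
  J (x, 0) (y, 0) (0, h) (u, 0) (0, k)
  = (0, beta y (rho x u k) h - beta x (rho y u k) h
        + rho x y (beta u h k) - beta u (rho x y h) k).
Proof. expand. Qed.

Lemma filippov_MMH_HH x y h k l :
  J (x, 0) (y, 0) (0, h) (0, k) (0, l)
  = (0, brH (rho x y h) k l + beta y (beta x k l) h - beta x (beta y k l) h
        - rho x y (brH h k l)).
Proof. expand. Qed.

Lemma filippov_MHH_MM x h k u v :
  J (x, 0) (0, h) (0, k) (u, 0) (v, 0)
  = (0, rho u v (beta x h k)
        - (beta (brM x u v) h k + brH (mu x u v) h k
           + beta x (rho u v h) k + beta x h (rho u v k))).
Proof. expand. Qed.

Lemma filippov_MHH_MH x h k u l :
  J (x, 0) (0, h) (0, k) (u, 0) (0, l)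
  = (0, beta x (beta u h l) k + beta x h (beta u k l) - beta u (beta x h k) l
        - brH (rho x u l) h k).
Proof. expand. Qed.

Lemma filippov_MHH_HH x h k l m :
  J (x, 0) (0, h) (0, k) (0, l) (0, m)
  = (0, brH (beta x h k) l m
        - (brH (beta x l m) h k + beta x (brH h l m) k + beta x h (brH k l m))).
Proof. expand. Qed.

Lemma filippov_HHH_MM h k l u v :
  J (0, h) (0, k) (0, l) (u, 0) (v, 0) = 0.
Proof.
have [_ rD] := rho_der data u v.
(* The right-hand 0 is traded for the failure of [rho u v] to be a derivation, which has the atoms
   that [expand] produces. *)
rewrite -[RHS](_ : (0, rho u v (brH h k l)
  - (brH (rho u v h) k l + brH h (rho u v k) l + brH h k (rho u v l))) = 0).
  expand.
by rewrite rD subrr.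
Qed.

Lemma filippov_HHH_MH h k l u m :
  J (0, h) (0, k) (0, l) (u, 0) (0, m) = 0.
Proof.
have [_ bD] := beta_der data u m.
rewrite -[RHS](_ : (0, beta u m (brH h k l)
  - (brH (beta u m h) k l + brH h (beta u m k) l + brH h k (beta u m l))) = 0).
  (* [ext_formula] yields [beta u h m] with a sign where the derivation rule has [beta u m h]. *)
  rewrite !(bs u _ m); expand.
by rewrite bD subrr.
Qed.

Lemma filippov_HHH_HH h k l m n :
  J (0, h) (0, k) (0, l) (0, m) (0, n) = 0.
Proof.
rewrite -[RHS](_ : (0, filippov brH h k l m n) = 0); first by expand.
by rewrite /filippov (tl_identity lieH) subrr.
Qed.

End Extension.

(** * Matching the vanishing of the defect with the seven identities *)

Theorem theorem3p5 (F : fieldType) (charF : 2%N \notin [pchar F])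
  (M H : lmodType F)
  (brM : M -> M -> M -> M) (brH : H -> H -> H -> H)
  (mu : M -> M -> M -> H) (rho : M -> M -> H -> H) (beta : M -> H -> H -> H)
  (brA : M * H -> M * H -> M * H -> M * H)
  (lieM : three_lie_algebra brM) (lieH : three_lie_algebra brH)
  (data : extension_data brH mu rho beta)
  (ext : extension_bracket brM brH mu rho beta brA) :
  three_lie_algebra brA <->
  (forall x1 x2 x3 x4 h,
     rho x1 x4 (rho x2 x3 h) + rho x2 x3 (rho x1 x4 h)
     + rho x1 x2 (rho x3 x4 h) + rho x3 x4 (rho x1 x2 h)
     - rho x1 x3 (rho x2 x4 h) - rho x2 x4 (rho x1 x3 h) = 0)
  /\
  (forall x1 x2 x3 x4 h,
     rho x4 (brM x1 x2 x3) h
     = rho x3 x1 (rho x4 x2 h) - rho x2 x1 (rho x4 x3 h)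
       + rho x2 x3 (rho x4 x1 h) - beta x4 (mu x1 x2 x3) h)
  /\
  (forall x y h h1 h2,
     beta y h2 (beta x h1 h) - beta y h (beta x h1 h2)
     - beta x h1 (beta y h2 h)
     = brH (rho x y h1) h2 h)
  /\
  (forall x h1 h2 h3 h,
     ad brH (beta x h1 h3) h2 h + ad brH h3 (beta x h1 h2) h
     + ad brH (beta x h3 h2) h1 h
     = beta x (brH h1 h2 h3) h)
  /\
  (forall x1 x2 x3 h1 h2,
     brH (mu x1 x2 x3) h1 h2
     = rho x2 x3 (beta x1 h1 h2) - rho x1 x3 (beta x2 h1 h2)
       + rho x1 x2 (beta x3 h1 h2) - beta (brM x1 x2 x3) h1 h2)
  /\
  (forall x1 x2 x3 h1 h2,
     beta x1 h1 (rho x2 x3 h2) + beta x3 h2 (rho x1 x2 h1)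
     = rho x2 x3 (beta x1 h1 h2) + beta x2 h2 (rho x1 x3 h1))
  /\
  (forall x1 x2 x3 x4 x5,
     mu x1 x2 (brM x3 x4 x5) - mu (brM x1 x2 x3) x4 x5
     - mu x3 (brM x1 x2 x4) x5 - mu x3 x4 (brM x1 x2 x5)
     = rho x3 x4 (mu x1 x2 x5) - rho x3 x5 (mu x1 x2 x4)
       - rho x1 x2 (mu x3 x4 x5) + rho x4 x5 (mu x1 x2 x3)).
Proof.
have bs x h k : beta x k h = - beta x h k.
  exact: (ext_bracket_skew_beta ext).
have [linA skewA _ _ _ _] := ext.
have [[H1 _ _] [sH sH'] _] := lieH.
have cM := skew3_cycle (tl_skew lieM).
have cm := skew3_cycle (mu_skew data).
have cH := skew3_cycle (tl_skew lieH).
have [_ _ dr _ _ rs db _ _] := data.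
have rN x y h : rho x y (- h) = - rho x y h.
  by apply: linear_opp; case: (dr x y).
have bN x h k : beta x h (- k) = - beta x h k.
  by apply: linear_opp; case: (db x h).
have HN h k l : brH (- h) k l = - brH h k l by apply: (linear_opp _ (H1 _ _)).
have neg := (rN, bN, HN).
have rD x y h k l : rho x y (brH h k l) =
    brH (rho x y h) k l + brH h (rho x y k) l + brH h k (rho x y l).
  by case: (dr x y).
have bD x m h k l : beta x m (brH h k l) =
    brH (beta x m h) k l + brH h (beta x m k) l + brH h k (beta x m l).
  by case: (db x m).
(* Instances that put the arguments of rho, beta x and brH a in a fixed order. *)
pose rs4 x y z t := (rs x y, rs x z, rs x t, rs y z, rs y t, rs z t).
pose bs4 h k l m := ((bs^~ h)^~ k, (bs^~ h)^~ l, (bs^~ h)^~ m,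
                     (bs^~ k)^~ l, (bs^~ k)^~ m, (bs^~ l)^~ m).
pose sH4 h k l m := ((sH'^~ h)^~ k, (sH'^~ h)^~ l, (sH'^~ h)^~ m,
                     (sH'^~ k)^~ l, (sH'^~ k)^~ m, (sH'^~ l)^~ m).
split.
  move=> lieA.
  have J0 a b c u v : (filippov brA a b c u v).2 = 0.
    by rewrite /filippov (tl_identity lieA) subrr.
  (* Stated separately because it gives (2) and is also needed to derive (1). *)
  have C2raw x y z u h :
      rho (brM x y z) u h - beta u (mu x y z) h
      - (rho y z (rho x u h) - rho x z (rho y u h) + rho x y (rho z u h)) = 0.
    have := J0 (x, 0) (y, 0) (z, 0) (u, 0) (0, h).
    by rewrite (filippov_MMM_MH lieM lieH data ext).
  split=> [x y u v h|].
    have := J0 (x, 0) (y, 0) (0, h) (u, 0) (v, 0).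
    rewrite (filippov_MMH_MM lieM lieH data ext) => E.
    (* The two instances cancel every term of [E] containing [brM] or [mu], so that only products of
       two values of [rho] remain. *)
    have := eqN (eqD E (eqD (C2raw x u v y h) (eqN (C2raw y u v x h)))).
    rewrite /= !(rs (brM _ _ _), rs4 x y u v, neg) => {}E.
    by apply: (zmod_from E); zmod.
  split=> [x1 x2 x3 x4 h|].
    have := eqN (C2raw x1 x2 x3 x4 h).
    rewrite !(rs (brM _ _ _), rs4 x1 x2 x3 x4, neg) => E.
    by apply: (zmod_from E); zmod.
  split=> [x y h h1 h2|].
    (* This order makes the [brH] term of the defect [brH (rho y x h1) h2 h], the right-hand side of
       (3) up to sign. *)
    have := J0 (y, 0) (0, h2) (0, h) (x, 0) (0, h1).
    rewrite (filippov_MHH_MH lieM lieH data ext) /=.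
    rewrite !((bs^~ h)^~ (beta _ _ _), (bs^~ h1)^~ (beta _ _ _)).
    rewrite !((bs^~ h1)^~ h, (bs^~ h1)^~ h2, rs x y, neg) => /eqN E.
    by apply: (zmod_from E); zmod.
  split=> [x h1 h2 h3 h|].
    have := J0 (x, 0) (0, h1) (0, h2) (0, h3) (0, h).
    rewrite (filippov_MHH_HH lieM lieH data ext) /ad /=.
    (* Once [brH] sits in the last slot of [beta], the derivation rule reduces the defect and (4)
       alike to brackets with a single inner [beta]. *)
    rewrite !((bs^~ h2)^~ (brH _ _ _), (bs^~ h)^~ (brH _ _ _)) !bD.
    rewrite !(sH (beta _ _ _), cH (beta _ _ _)).
    rewrite !(bs4 h1 h2 h3 h, sH4 h1 h2 h3 h, neg) => E.
    by apply: (zmod_from E); zmod.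
  split=> [x1 x2 x3 h1 h2|].
    have := J0 (x1, 0) (x2, 0) (x3, 0) (0, h1) (0, h2).
    rewrite (filippov_MMM_HH lieM lieH data ext) /= => E.
    by apply: (zmod_from E); zmod.
  split=> [x1 x2 x3 h1 h2|x1 x2 x3 x4 x5].
    have := J0 (x2, 0) (x3, 0) (0, h2) (x1, 0) (0, h1).
    rewrite (filippov_MMH_MH lieM lieH data ext) /=.
    rewrite !((bs^~ h2)^~ (rho _ _ _), (bs^~ h1)^~ (rho _ _ _)).
    rewrite !((bs^~ h1)^~ h2, rs x1 x2, rs x1 x3, neg) => E.
    by apply: (zmod_from E); zmod.
  (* In (7) the pair [x1], [x2] acts from the left, in the defect from the right; cyclic shifts pass
     between the two without a sign. *)
  have := J0 (x3, 0) (x4, 0) (x5, 0) (x1, 0) (x2, 0).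
  rewrite (filippov_MMM_MM lieM lieH data ext) /=.
  rewrite !(cM _ x1 x2, cm _ x1 x2) => E.
  by apply: (zmod_from E); zmod.
case=> C1 [C2 [C3 [C4 [C5 [C6 C7]]]]].
(* Trilinearity and skew-symmetry come with the extension bracket, so only the vanishing of the
   defect is left. *)
split=> // x y z u v; apply/eqP; rewrite -subr_eq0; apply/eqP.
move: x y z u v; apply: (filippov_direct_sum linA skewA).
- move=> x y z u v; rewrite (filippov_MMM_MM lieM lieH data ext).
  apply: injective_projections => /=.
    by rewrite /filippov (tl_identity lieM) subrr.
  move: (C7 u v x y z); rewrite !(cM _ u v, cm _ u v) => E.
  by apply: (zmod_from E); zmod.
- move=> x y z u h; rewrite (filippov_MMM_MH lieM lieH data ext).
  apply: injective_projections => //=.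
  move: (C2 x y z u h); rewrite !(rs (brM _ _ _), rs4 x y z u, neg) => /eqN E.
  by apply: (zmod_from E); zmod.
- move=> x y z h k; rewrite (filippov_MMM_HH lieM lieH data ext).
  apply: injective_projections => //=.
  by apply: (zmod_from (C5 x y z h k)); zmod.
- move=> x y h u v; rewrite (filippov_MMH_MM lieM lieH data ext).
  apply: injective_projections => //=.
  (* Conversely, two instances of (2) restore the terms with [brM] and [mu] that are absent from
     (1). *)
  have := eqD (C1 x y u v h) (eqD (C2 y u v x h) (eqN (C2 x u v y h))).
  rewrite !(rs (brM _ _ _), rs4 x y u v, neg) => /eqN E.
  by apply: (zmod_from E); zmod.
- move=> x y h u k; rewrite (filippov_MMH_MH lieM lieH data ext).
  apply: injective_projections => //=.
  move: (C6 u x y k h).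
  rewrite !((bs^~ h)^~ (rho _ _ _), (bs^~ k)^~ (rho _ _ _)).
  rewrite !((bs^~ k)^~ h, rs u x, rs u y, neg) => E.
  by apply: (zmod_from E); zmod.
- move=> x y h k l; rewrite (filippov_MMH_HH lieM lieH data ext).
  apply: injective_projections => //=.
  (* With T_i = [rho(x,y) h_i, h_j, h_k] and P_i, Q_i the terms
     beta(x,h_i) beta(y,h_j) h_k and beta(y,h_i) beta(x,h_j) h_k, (3) reads
     T_i = - P_i - Q_j - Q_k; exchanging x and y gives sum P = - sum Q, hence
     T_j + T_k = P_i - Q_i. *)
  have := eqD (eqN (eqD (C3 x y l h k) (C3 y x l h k)))
              (eqD (C3 x y h k l) (C3 x y k l h)).
  rewrite rD !((bs^~ h)^~ (beta _ _ _)) !(sH (rho _ _ _), cH (rho _ _ _)).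
  rewrite !(rs x y, bs4 h k l l, sH4 h k l l, neg) => E.
  by apply: (zmod_from E); zmod.
- move=> x h k u v; rewrite (filippov_MHH_MM lieM lieH data ext).
  apply: injective_projections => //=.
  (* Besides the cyclic instances of (6), the one with h and k exchanged is what
     makes division by 2 unnecessary. *)
  have := eqD (eqN (eqD (C5 x u v h k) (eqD (C6 x u v h k) (C6 x u v k h))))
              (eqD (C6 u v x h k) (C6 v x u h k)).
  rewrite !((bs^~ k)^~ (rho _ _ _)).
  rewrite !(rs x u, rs x v, rs u v, (bs^~ h)^~ k, neg) => E.
  by apply: (zmod_from E); zmod.
- move=> x h k u l; rewrite (filippov_MHH_MH lieM lieH data ext).
  apply: injective_projections => //=.
  move: (C3 u x k l h).
  rewrite !((bs^~ k)^~ (beta _ _ _), (bs^~ l)^~ (beta _ _ _)).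
  rewrite !((bs^~ l)^~ k, (bs^~ l)^~ h, rs u x, neg) => /eqN E.
  by apply: (zmod_from E); zmod.
- move=> x h k l m; rewrite (filippov_MHH_HH lieM lieH data ext).
  apply: injective_projections => //=.
  move: (C4 x h k l m); rewrite /ad.
  rewrite !((bs^~ k)^~ (brH _ _ _), (bs^~ m)^~ (brH _ _ _)) !bD.
  rewrite !(sH (beta _ _ _), cH (beta _ _ _)).
  rewrite !(bs4 h k l m, sH4 h k l m, neg) => E.
  by apply: (zmod_from E); zmod.
- exact: (filippov_HHH_MM lieM lieH data ext).
- exact: (filippov_HHH_MH lieM lieH data ext).
- exact: (filippov_HHH_HH lieM lieH data ext).
Qed.
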